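(* Let $m$ be an odd positive integer, $n$ a positive integer, and let $\mathcal{C}$ be an order $m$ dimension $n$ symmetric Cauchy tensor with generating vector $c=(c_1,\ldots,c_n)\in\mathbb{R}^n$ satisfying $c_i>0$ for all $i\in[n]$. Let $\lambda\in\mathbb{R}$ be a Z-eigenvalue of $\mathcal{C}$ with Z-eigenvector $x=(x_1,\ldots,x_n)\in\mathbb{R}^n$. If $\lambda>0$, then $x\ge 0$; if $\lambda<0$, then $x\le 0$ (entrywise inequalities).
   Context: $[n]=\{1,\ldots,n\}$. An order $m$ dimension $n$ symmetric Cauchy tensor with generating vector $c=(c_1,\ldots,c_n)\in\mathbb{R}^n$ is the real tensor $\mathcal{C}=(c_{i_1\cdots i_m})$ with entries $c_{i_1i_2\cdots i_m}=\frac{1}{c_{i_1}+c_{i_2}+\cdots+c_{i_m}}$, $i_1,\ldots,i_m\in[n]$, where it is assumed that $c_{i_1}+\cdots+c_{i_m}\neq 0$ for all $i_1,\ldots,i_m\in[n]$. A real number $\lambda$ and a vector $x\in\mathbb{R}^n$ are a Z-eigenvalue of an order $m$ dimension $n$ tensor $\mathcal{A}=(a_{i_1\cdots i_m})$ and a Z-eigenvector of $\mathcal{A}$ corresponding to $\lambda$ if $\mathcal{A}x^{m-1}=\lambda x$ and $x^Tx=1$, where $(\mathcal{A}x^{m-1})_i=\sum_{i_2,\ldots,i_m\in[n]}a_{ii_2\cdots i_m}x_{i_2}\cdots x_{i_m}$. *)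

(* Defs.v *)
From HB Require Import structures.
From mathcomp Require Import all_boot all_order all_algebra.
From mathcomp Require Import reals.

Set Implicit Arguments.
Unset Strict Implicit.
Unset Printing Implicit Defensive.

Import Order.TTheory GRing.Theory Num.Theory.
Local Open Scope ring_scope.

(* The index set [n] is 'I_n; the entry a_{i_1 ... i_m} is A [tuple i_1; ...]. *)
Definition tensor (R : realType) (m n : nat) : Type :=
  {ffun m.-tuple 'I_n -> R}.

(* The nonvanishing of c_{i_1} + ... + c_{i_m} is part of being a Cauchy tensor;
   the entries are then symmetric in the indices by construction. *)
Definition cauchy_tensor (R : realType) (m n : nat)
    (A : tensor R m n) (c : 'cV[R]_n) : Prop :=
  forall t : m.-tuple 'I_n,
    \sum_(j <- t) c j 0 != 0 /\ A t = 1 / \sum_(j <- t) c j 0.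

(* A x^{m-1}: for each i, the sum runs over the multi-indices (i, i_2, ..., i_m),
   i.e. the m-tuples with first component i; [behead t] is (i_2, ..., i_m).
   Meaningful for 0 < m only. *)
Definition tensor_app (R : realType) (m n : nat)
    (A : tensor R m n) (x : 'cV[R]_n) : 'cV[R]_n :=
  \col_i \sum_(t : m.-tuple 'I_n | ohead t == Some i)
           A t * \prod_(j <- behead t) x j 0.

Definition Z_eigenpair (R : realType) (m n : nat)
    (A : tensor R m n) (lambda : R) (x : 'cV[R]_n) : Prop :=
  tensor_app A x = lambda *: x /\ x^T *m x = 1%:M.

(* Main.v *)
Require Import Defs.
From mathcomp Require Import all_boot all_order all_algebra.
From mathcomp Require Import reals ring.

Import Order.TTheory GRing.Theory Num.Theory.
Local Open Scope ring_scope.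

(** Put [m = 2k + 1]. Splitting each multi-index [(i_2, ..., i_m)] into two
    [k]-tuples [u, v] writes [(C x^(m-1))_i] as the quadratic form
    [\sum_(u, v) X_u X_v / (b_u + b_v)], where [X_u] is the product of the
    [x_j] and [b_u] is [c_i / 2] plus the sum of the [c_j], over [j] in [u].
    This is the form of a positive semidefinite Cauchy matrix, so
    [lambda x_i >= 0] for every [i]. *)

(* Schur complement with respect to the first index [o]:
   [1/(b_i + b_j) = 2 b_o / ((b_i + b_o) (b_j + b_o))
      + (b_i - b_o) (b_j - b_o) / ((b_i + b_o) (b_j + b_o) (b_i + b_j))],
   whose second term vanishes as soon as [i] or [j] is [o]. *)
Lemma cauchy_form_ge0 (R : realFieldType) (I : Type) (b f : I -> R)
    (r : seq I) :
  (forall i, 0 < b i) ->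
  0 <= \sum_(i <- r) \sum_(j <- r) f i * f j / (b i + b j).
Proof.
move=> b_gt0; have bD_neq0 i j : b i + b j != 0 by rewrite gt_eqF ?addr_gt0.
elim: r f => [|o r IHr] f; first by rewrite big_nil.
pose g i := f i * (b i - b o) / (b i + b o).
have go : g o = 0 by rewrite /g subrr mulr0 mul0r.
have -> : \sum_(i <- o :: r) \sum_(j <- o :: r) f i * f j / (b i + b j) =
    2 * b o * (\sum_(i <- o :: r) f i / (b i + b o)) ^+ 2 +
    \sum_(i <- o :: r) \sum_(j <- o :: r) g i * g j / (b i + b j).
  rewrite expr2 mulr_suml mulr_sumr -big_split; apply: eq_bigr => i _ /=.
  rewrite !mulr_sumr -big_split; apply: eq_bigr => j _ /=.
  by rewrite /g; field; rewrite !bD_neq0.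
apply: addr_ge0; first by rewrite mulr_ge0 ?sqr_ge0 ?mulr_ge0 ?ltW.
(* As [g o = 0], the row and column of [o] vanish, leaving the form of [g] over [r]; hence the
   induction with [f] general. *)
rewrite big_cons big1 ?add0r => [|j _]; last by rewrite go !mul0r.
under eq_bigr => i _ do rewrite big_cons go mulr0 mul0r add0r.
exact: IHr.
Qed.

Lemma big_tuple_cons (R : nmodType) (T : finType) (n : nat) (i : T)
    (F : n.+1.-tuple T -> R) :
  \sum_(t : n.+1.-tuple T | ohead t == Some i) F t =
  \sum_(s : n.-tuple T) F [tuple of i :: s].
Proof.
rewrite (reindex_onto (fun s : n.-tuple T => [tuple of i :: s])
                      (fun t => [tuple of behead t])) /=; last first.
  by move=> t; case/tupleP: t => j s /= /eqP[->]; apply: val_inj.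
apply: eq_bigl => s; rewrite eqxx /=; apply/eqP.
exact: val_inj.
Qed.

Lemma big_tuple_cat (R : nmodType) (T : finType) (p q : nat)
    (F : (p + q).-tuple T -> R) :
  \sum_(t : (p + q).-tuple T) F t =
  \sum_(u : p.-tuple T) \sum_(v : q.-tuple T) F [tuple of u ++ v].
Proof.
rewrite pair_bigA /=.
rewrite (reindex (fun w : p.-tuple T * q.-tuple T => [tuple of w.1 ++ w.2])) //.
apply: onW_bij; apply: inj_card_bij; last first.
  by rewrite card_prod !card_tuple expnD.
move=> [u v] [u' v'] /(congr1 val) /= /eqP.
by rewrite eqseq_cat ?size_tuple // => /andP[/eqP/val_inj-> /eqP/val_inj->].
Qed.

Lemma cauchy_tensor_app_ge0 (R : realType) (m n : nat) (C : tensor R m n)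
    (c x : 'cV[R]_n) (i : 'I_n) :
  odd m -> cauchy_tensor C c -> (forall j, 0 < c j 0) ->
  0 <= tensor_app C x i 0.
Proof.
(* From here on [m] stands for the order minus one, which is even. *)
case: m C => // m C m_even C_cauchy c_gt0.
have {m_even} [k mE] : exists k, m = (k + k)%N.
  by exists m./2; rewrite addnn even_halfK.
subst m; rewrite mxE big_tuple_cons big_tuple_cat.
(* Each half carries [c i 0 / 2], so that [b u + b v] is the whole denominator and [b u] is positive
   even for [k = 0]. *)
pose b (u : k.-tuple 'I_n) := c i 0 / 2 + \sum_(j <- u) c j 0.
pose X (u : k.-tuple 'I_n) := \prod_(j <- u) x j 0.
have b_gt0 u : 0 < b u.
  by rewrite ltr_wpDr ?divr_gt0 // sumr_ge0 // => j _; apply: ltW.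
rewrite (_ : \sum_u _ = \sum_u \sum_v X u * X v / (b u + b v)).
  exact: cauchy_form_ge0.
apply: eq_bigr => u _; apply: eq_bigr => v _.
rewrite (C_cauchy _).2 /= big_cons !big_cat /= mul1r mulrC.
by congr (_ / _); rewrite /b; field.
Qed.

Theorem theorem3p2 (R : realType) (m n : nat) (m_gt0 : (0 < m)%N)
    (m_odd : odd m) (n_gt0 : (0 < n)%N)
    (C : tensor R m n) (c : 'cV[R]_n) (C_cauchy : cauchy_tensor C c)
    (c_gt0 : forall i : 'I_n, 0 < c i 0)
    (lambda : R) (x : 'cV[R]_n) (Cx : Z_eigenpair C lambda x) :
  (0 < lambda -> forall i : 'I_n, 0 <= x i 0) /\
  (lambda < 0 -> forall i : 'I_n, x i 0 <= 0).
Proof.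
have lambda_x_ge0 i : 0 <= lambda * x i 0.
  have := @cauchy_tensor_app_ge0 R m n C c x i m_odd C_cauchy c_gt0.
  by rewrite Cx.1 mxE.
split=> lambda_sgn i; have := lambda_x_ge0 i.
  by rewrite pmulr_rge0.
by rewrite nmulr_rge0.
Qed.
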